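(* Let $n\ge d>0$ be integers and let $x$ be an indeterminate. Define $v_0=2$, $v_1=x-2$ and $v_{k+1}=(x-2)v_k-v_{k-1}$ for $k\ge1$. Then $$d\sum_{k=1}^{n}\binom{2k}{k+d}\frac{x^{n-k}}{k}=\sum_{k=0}^{n-d}\binom{2n}{n+d+k}v_k-\binom{2n}{n+d}.$$ *)

(* Defs.v *)
From mathcomp Require Import all_boot all_order all_algebra.

Set Implicit Arguments.
Unset Strict Implicit.
Unset Printing Implicit Defensive.

Import GRing.Theory.
Local Open Scope ring_scope.

Fixpoint v (k : nat) : {poly rat} :=
  match k with
  | 0 => 2%:R
  | k1.+1 =>
      match k1 with
      | 0 => 'X - 2%:R
      | k0.+1 => ('X - 2%:R) * v k1 - v k0
      end
  end.

(* Main.v *)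
Require Import Defs.
From mathcomp Require Import all_boot all_order all_algebra.
From mathcomp Require Import ring lra zify.

(** Both sides satisfy the same first-order recurrence in [n].  The left side
    [L_n] satisfies [L_(n+1) = x L_n + d C(2n+2, n+1+d) / (n+1)].  For the right
    side [R_n], the relation [x v_k = v_(k+1) + 2 v_k + v_(k-1)] moves the
    multiplication by [x] onto the binomials, where two applications of Pascal's
    rule give [C(2n+2, _)]; the boundary terms at [k = 0] leave
    [R_(n+1) - x R_n = C(2n, n+d-1) - C(2n, n+d+1)], which is the same
    increment.  Both sides vanish at [n = 0]. *)

Set Implicit Arguments.
Unset Strict Implicit.
Unset Printing Implicit Defensive.

Import GRing.Theory.
Local Open Scope ring_scope.

(** Shift the summation index in each term of ['X * v k], whose three-term relation also holds at
    [k = 0] with [v_(-1) = v_1]; this reflected term gives [c 1 * v 1]. *)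
Lemma mulX_sum_v (c : nat -> {poly rat}) N :
  'X * \sum_(0 <= k < N.+1) c k.+1 * v k
  = \sum_(0 <= k < N.+1) (c k + 2%:R * c k.+1 + c k.+2) * v k
    + c 1%N * v 1 - 2%:R * c 0%N + c N.+1 * v N.+1 - c N.+2 * v N.
Proof.
elim: N => [|N IHN]; first by rewrite !big_nat1 /=; ring.
by rewrite big_nat_recr //= mulrDr IHN [in RHS]big_nat_recr //= -/(v N.+1); ring.
Qed.

Lemma binSS m p : 'C(m.+2, p.+2) = ('C(m, p) + 2 * 'C(m, p.+1) + 'C(m, p.+2))%N.
Proof. by rewrite !binS mul2n -addnn; ring. Qed.

Lemma mul_bin_left_ring (R : pzRingType) m p :
  p.+1%:R * 'C(m, p.+1)%:R = (m%:R - p%:R) * 'C(m, p)%:R :> R.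
Proof.
rewrite -natrM mul_bin_left natrM; have [lepm|ltmp] := leqP p m.
  by rewrite natrB.
(* For [p > m] truncated subtraction is harmless: the binomial is zero. *)
by rewrite bin_small // !mulr0.
Qed.

Lemma bin_central_diff (n e : nat) :
  e.+1%:R * ('C((2 * n).+2, (n + e).+2)%:R / n.+1%:R)
  = 'C(2 * n, n + e)%:R - 'C(2 * n, (n + e).+2)%:R :> rat.
Proof.
have n1_neq0 : n.+1%:R != 0 :> rat by rewrite Num.Theory.pnatr_eq0.
apply: (mulIf n1_neq0); rewrite mulrA mulfVK // binSS.
(* Adding these two ratio relations between consecutive binomials gives the claim. *)
have := mul_bin_left_ring rat (2 * n) (n + e).
have := mul_bin_left_ring rat (2 * n) (n + e).+1.
move: 'C(2 * n, n + e) 'C(2 * n, (n + e).+1) 'C(2 * n, (n + e).+2) => y z w.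
rewrite !natrD => h1 h2.
by lra.
Qed.

(** Summing up to [n] instead of [n - d] frees the statement from [d <= n], so the induction can
    start at [n = 0]. *)
Lemma sum_bin_div_v (n e : nat) :
  e.+1%:R * \sum_(1 <= k < n.+1)
           (('C((2 * k)%N, (k + e.+1)%N)%:R / k%:R : rat) *: 'X^(n - k))
  = \sum_(0 <= k < n.+1) 'C((2 * n)%N, (n + e.+1 + k)%N)%:R * v k
    - 'C((2 * n)%N, (n + e.+1)%N)%:R :> {poly rat}.
Proof.
elim: n => [|n IHn].
  by rewrite big_geq // big_nat1 /= mulr0 !bin_small // mul0r subrr.
rewrite big_nat_recr //= subnn expr0.
have -> : \sum_(1 <= k < n.+1)
    (('C(2 * k, k + e.+1)%:R / k%:R : rat) *: 'X^(n.+1 - k))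
  = 'X * \sum_(1 <= k < n.+1)
    (('C(2 * k, k + e.+1)%:R / k%:R : rat) *: 'X^(n - k)) :> {poly rat}.
  rewrite mulr_sumr; apply: eq_big_nat => k /andP[_ lekn].
  by rewrite subSn // exprS scalerAr.
rewrite mulrDr mulrCA IHn.
have -> : (2 * n.+1 = (2 * n).+2)%N by rewrite mulnS.
have -> : (n.+1 + e.+1 = (n + e).+2)%N by rewrite addSn addnS.
rewrite [e.+1%:R * _]mulr_natl -[_ *+ e.+1]scaler_nat scalerA bin_central_diff.
have inc : ('C(2 * n, n + e)%:R - 'C(2 * n, (n + e).+2)%:R : rat) *: 1
  = 'C(2 * n, n + e)%:R - 'C(2 * n, (n + e).+2)%:R :> {poly rat}.
  by rewrite scalerBl !scaler_nat.
(* Starting [c] at [n + e] puts the coefficients for [n] at [c k.+1]; the bound [n.+1] matches the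
   sum for [n.+1], and the extra top terms vanish. *)
have recur := mulX_sum_v (fun j => 'C(2 * n, n + e + j)%:R) n.+1.
have a1 : 'C(2 * n, n + e + n.+2) = 0%N by apply: bin_small; lia.
have a2 : 'C(2 * n, n + e + n.+3) = 0%N by apply: bin_small; lia.
move: recur; rewrite /= a1 a2 !mul0r subr0 addr0 big_nat_recr //= a1 mul0r addr0.
under eq_bigr do rewrite addnS -addSn -addnS.
move=> recur; rewrite mulrBr recur inc.
under eq_bigr do rewrite !addnS -natrM -!natrD -binSS -!addSn.
by rewrite binSS !natrD addn0 addn1 addnS /=; ring.
Qed.

Theorem theorem3p1 (n d : nat) (hd : (0 < d)%N) (hdn : (d <= n)%N) :
  d%:R * \sum_(1 <= k < n.+1)
           (('C((2 * k)%N, (k + d)%N)%:R / k%:R : rat) *: 'X^(n - k))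
  = \sum_(0 <= k < (n - d).+1) 'C((2 * n)%N, (n + d + k)%N)%:R * v k
    - 'C((2 * n)%N, (n + d)%N)%:R :> {poly rat}.
Proof.
case: d hd hdn => // e _ len; rewrite sum_bin_div_v.
(* Terms with [k > n - d] vanish, since then [n + d + k > 2n]. *)
rewrite (big_cat_nat (n := (n - e.+1).+1)) ?ltnS ?leq_subr //=.
rewrite [X in _ + X - _]big_nat [X in _ + X - _]big1 ?addr0 // => k /andP[ltk _].
by rewrite bin_small ?mul0r //; lia.
Qed.
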